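(* Let $((X_i,Y_i))_{i\geq 1}$ be an i.i.d. sequence such that for each $i$, $X_i$ and $Y_i$ are independent with \[ \mathbb{P}(X_i=k)=\mathbb{P}(Y_i=k)=\frac{1}{k\,2^{2k-1}}\binom{2k-2}{k-1},\qquad k=1,2,3,\dots \] Let $N$ and $M$ be independent Geometric$(1/2)$ random variables, also jointly independent of the sequence $((X_i,Y_i))_{i\geq1}$. For each $n\ge 1$ let $\tau_n$ be a uniformly random element of $\mathrm{Av}_n(321)$. Then, as $n\to\infty$, \[ \left( \sum_{i=1}^{\lfloor n/2\rfloor} \delta_i \mathbf{1}_{\{\tau_n(i)=i\}} ,\ \sum_{i=\lfloor n/2\rfloor+1}^n \delta_{n+1-i} \mathbf{1}_{\{\tau_n(i)=i\}} \right) \overset{d}{\longrightarrow} \left( \sum_{k=1}^{N} \delta_{\sum_{j=1}^k X_j} \mathbf{1}_{\{X_k=1\}} ,\ \sum_{k=1}^{M} \delta_{\sum_{j=1}^k Y_j} \mathbf{1}_{\{Y_k=1\}} \right),\] where the convergence is convergence in distribution on $\mathcal{M}_F(\{1,2,3,\dots\})^2$.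
   Context: For $\sigma\in S_k$ and $\tau\in S_n$ ($k\le n$), $\tau$ contains the pattern $\sigma$ if there are indices $i_1<\dots<i_k$ with $\tau(i_s)<\tau(i_t)$ iff $\sigma(s)<\sigma(t)$ for all $1\le s<t\le k$; otherwise $\tau$ avoids $\sigma$. $\mathrm{Av}_n(\sigma)$ is the set of $\sigma$-avoiding permutations in $S_n$. A Geometric$(1/2)$ random variable takes values in $\{0,1,2,\dots\}$ with $\mathbb{P}(=k)=2^{-k-1}$. $\delta_x$ denotes the unit point mass at $x$. $\mathcal{M}_F(\{1,2,3,\dots\})$ is the set of finite measures on $\{1,2,3,\dots\}$ with the topology of weak convergence, i.e. the topology generated by the maps $\mu\mapsto\int f\,d\mu$ for all bounded $f:\{1,2,3,\dots\}\to\mathbb{R}$. *)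

(* Defs.v *)
From mathcomp Require Import all_boot all_fingroup.
From Stdlib Require Import Reals ClassicalEpsilon.

Set Implicit Arguments.
Unset Strict Implicit.
Unset Printing Implicit Defensive.

Definition contains (k n : nat) (sigma : 'S_k) (tau : 'S_n) : bool :=
  [exists f : {ffun 'I_k -> 'I_n},
     [forall s : 'I_k, forall t : 'I_k,
        (s < t)%N ==> ((f s < f t)%N &&
                       ((tau (f s) < tau (f t))%N == (sigma s < sigma t)%N))]].

Definition avoids (k n : nat) (sigma : 'S_k) (tau : 'S_n) : bool :=
  ~~ contains sigma tau.

Definition p321 : 'S_3 := perm (@rev_ord_inj 3).

Definition Av (k n : nat) (sigma : 'S_k) : {set 'S_n} :=
  [set tau : 'S_n | avoids sigma tau].

(* The value of a convergent series (arbitrary if it diverges; all series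
   used below converge absolutely). *)
Definition sumR (u : nat -> R) : R :=
  proj1_sig (constructive_indefinite_description
               (fun l => (exists l', infinite_sum u l') -> infinite_sum u l)
               (match classic (exists l', infinite_sum u l') with
                | or_introl H => let (l', Hl) := H in
                    ex_intro _ l' (fun _ => Hl)
                | or_intror H => ex_intro _ 0%R (fun H' => False_ind _ (H H'))
                end)).

(* A measure on {1,2,3,...} is represented by its mass function nat -> R
   (value at 0 must be 0); it is finite iff the masses are summable. *)
Definition finite_measure (mu : nat -> R) : Prop :=
  mu 0%N = 0%R /\ (forall j, (0 <= mu j)%R) /\ exists s, infinite_sum mu s.

Definition bounded_fun (f : nat -> R) : Prop :=
  exists B, forall j, (Rabs (f j) <= B)%R.

Definition integral (f : nat -> R) (mu : nat -> R) : R :=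
  sumR (fun j => f j * mu j)%R.

(* Continuity of g : M_F x M_F -> R at every point of M_F^2, for the product
   of the weak topologies (generated by mu |-> \int f dmu, f bounded). A basic
   neighbourhood is determined by finitely many bounded test functions. *)
Definition weak_continuous (g : (nat -> R) -> (nat -> R) -> R) : Prop :=
  forall m1 m2, finite_measure m1 -> finite_measure m2 ->
  forall eps, (0 < eps)%R ->
  exists (fs : list (nat -> R)) (delta : R),
    (0 < delta)%R /\ (forall f, List.In f fs -> bounded_fun f) /\
    forall m1' m2', finite_measure m1' -> finite_measure m2' ->
      (forall f, List.In f fs ->
         (Rabs (integral f m1' - integral f m1) < delta)%R /\
         (Rabs (integral f m2' - integral f m2) < delta)%R) ->
      (Rabs (g m1' m2' - g m1 m2) < eps)%R.

Definition bounded_on_MF2 (g : (nat -> R) -> (nat -> R) -> R) : Prop :=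
  exists B, forall m1 m2, finite_measure m1 -> finite_measure m2 ->
    (Rabs (g m1 m2) <= B)%R.

(* tau (1-indexed) fixes the point i, i.e. tau(i) = i. *)
Definition fixes1 (n : nat) (tau : 'S_n) (i : nat) : bool :=
  [exists x : 'I_n, (val x == i.-1) && (0 < i)%N && (tau x == x)].

Definition lhs1 (n : nat) (tau : 'S_n) : nat -> R :=
  fun j => if (1 <= j <= n./2)%N && fixes1 tau j then 1%R else 0%R.

(* sum_{i=floor(n/2)+1}^{n} delta_{n+1-i} 1{tau(i)=i}: point j = n+1-i *)
Definition lhs2 (n : nat) (tau : 'S_n) : nat -> R :=
  fun j => if (1 <= j <= n - n./2)%N && fixes1 tau (n.+1 - j) then 1%R else 0%R.

Definition lhs_expect (n : nat) (g : (nat -> R) -> (nat -> R) -> R) : R :=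
  (/ INR #|Av n p321| *
   \big[Rplus/0%R]_(tau in Av n p321) g (lhs1 tau) (lhs2 tau))%R.

Definition pX (k : nat) : R :=
  (INR 'C(k.*2 - 2, k.-1) / (INR k * 2 ^ (k.*2 - 1)))%R.

Definition pGeom (n : nat) : R := ((/ 2) ^ n.+1)%R.

(* Given the realised values xs = [X_1; ...; X_N], the measure
   sum_{k=1}^N delta_{X_1+...+X_k} 1{X_k = 1}. *)
Fixpoint walk_meas_nat (offset : nat) (xs : seq nat) (j : nat) : nat :=
  match xs with
  | [::] => 0
  | x :: xs' => (if (x == 1) && (offset + x == j) then 1 else 0)
                + walk_meas_nat (offset + x) xs' j
  end.

Definition walk_meas (xs : seq nat) : nat -> R :=
  fun j => INR (walk_meas_nat 0 xs j).

(* Expectation of h(X_1,...,X_n) for X_i i.i.d. with law pX (iterated series;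
   the summation index k stands for the value k+1). *)
Fixpoint iid_expect (n : nat) (h : seq nat -> R) : R :=
  match n with
  | 0 => h [::]
  | n'.+1 => sumR (fun k => pX k.+1 * iid_expect n' (fun l => h (k.+1 :: l)))%R
  end.

Definition rhs_expect (g : (nat -> R) -> (nat -> R) -> R) : R :=
  sumR (fun n => sumR (fun m =>
    pGeom n * pGeom m *
    iid_expect n (fun xs => iid_expect m (fun ys => g (walk_meas xs) (walk_meas ys)))))%R.

Definition conv_in_distribution : Prop :=
  forall g : (nat -> R) -> (nat -> R) -> R,
    bounded_on_MF2 g -> weak_continuous g ->
    Un_cv (fun n => lhs_expect n g) (rhs_expect g).

(* Main.v *)
From HB Require Import structures.
From Stdlib Require Import Reals Lra FunctionalExtensionality.
From Coquelicot Require Import Coquelicot.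
From mathcomp Require Import all_boot all_fingroup zify.
Require Import Defs.

Set Implicit Arguments.
Unset Strict Implicit.
Unset Printing Implicit Defensive.

(** A 321-avoiding permutation [tau] is determined by its running maximum
    [M i = max_{j < i} (tau j + 1)], an arbitrary staircase above the diagonal.
    The reversed list of the excesses [M i - i] is a Catalan word, and the fixed
    points of [tau] are the places where two consecutive excesses vanish, i.e.
    the blocks of size 1 when the word is cut at its zeros.  A block of size [k]
    can be filled in [catalan (k - 1)] ways, so the probability that the blocks
    are [ys], one big block, and [xs] read backwards is
      [block_count xs * block_count ys * catalan (n - |xs| - |ys| - 1) / catalan n],
    which tends to [P(N = size xs, X = xs) * P(M = size ys, Y = ys)] because
    [catalan n / catalan (n + 1) -> 1/4].  The limits are the weights of a
    probability measure on a countable set, so (Scheffe) the convergence holds in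
    total variation, and every bounded test function passes to the limit. *)

Local Open Scope nat_scope.

(** * Catalan words *)

(** Each letter exceeds its predecessor by at most one. [s] is a strict bound on the first letter,
    so [dyck 1] gives the Catalan words, which start at 0. *)
Fixpoint dyck (s : nat) (g : seq nat) : bool :=
  if g is b :: g' then (b < s) && dyck b.+2 g' else true.

Fixpoint dycks (s n : nat) : seq (seq nat) :=
  if n is n'.+1 then [seq b :: g | b <- iota 0 s, g <- dycks b.+2 n']
  else [:: [::]].

Lemma mem_dycks s n g : (g \in dycks s n) = (size g == n) && dyck s g.
Proof.
elim: n s g => [|n IH] s g /=; first by rewrite inE; case: g.
apply/allpairsPdep/idP => [[b] [g'] [bs g'D ->]|].
  by move: bs g'D; rewrite mem_iota IH /= => -> /andP[/eqP-> ->]; rewrite eqxx.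
case: g => [//|b g] /=; rewrite eqSS => /and3P[gn bs gD].
by exists b, g; rewrite mem_iota IH gn bs gD.
Qed.

Lemma uniq_dycks s n : uniq (dycks s n).
Proof.
elim: n s => [//|n IH] s /=; apply: allpairs_uniq_dep.
- exact: iota_uniq.
- by move=> b _; apply: IH.
- by move=> [b g] [b' g'] _ _ [-> ->].
Qed.

(** Split according to whether the first letter is below [s] or equal to [s]. *)
Lemma size_dycksS s n :
  size (dycks s.+1 n.+1) = size (dycks s n.+1) + size (dycks s.+2 n).
Proof.
by rewrite -{1}[s.+1]addn1 /= iotaD allpairs_cat size_cat /= cats0 size_map.
Qed.

(** Ballot numbers, written without subtraction. Raising [s] is Pascal's rule for both binomials,
    with [n] lowered and [s] raised by two in the second summand. *)
Lemma size_dycks_bin s n :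
  size (dycks s n.+1) + 'C((n.*2 + s).+1, n) = 'C((n.*2 + s).+1, n.+1).
Proof.
elim: n s => [|n IHn] s.
  rewrite bin0 bin1 /=; elim: s => [//|s IHs].
  by rewrite (size_dycksS s 0) /=; lia.
elim: s => [|s IHs].
  (* At [s = 0] there are no words, and the two binomials agree by symmetry. *)
  rewrite /= addn0; have := @bin_sub n.+1.*2.+1 n.+2.
  by rewrite (_ : n.+1.*2.+1 - n.+2 = n.+1) => [->|]; lia.
rewrite size_dycksS; have := IHn s.+2; move: IHs.
rewrite (_ : (n.*2 + s.+2).+1 = (n.+1.*2 + s).+1); last by lia.
rewrite (_ : n.+1.*2 + s.+1 = (n.+1.*2 + s).+1); last by lia.
set A := (n.+1.*2 + s).+1; rewrite (binS A n.+1) (binS A n).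
by move: (size _) (size _) => a b; lia.
Qed.

Definition catalan n := size (dycks 1 n).

Lemma catalan_bin n : n.+1 * catalan n = 'C(n.*2, n).
Proof.
case: n => [//|n]; have := size_dycks_bin 1 n; rewrite -/(catalan _).
rewrite (_ : (n.*2 + 1).+1 = n.+1.*2); last by lia.
have := mul_bin_left n.+1.*2 n.
rewrite (_ : n.+1.*2 - n = n.+2); last by lia.
by nia.
Qed.

Lemma catalan_gt0 n : 0 < catalan n.
Proof.
have : 0 < 'C(n.*2, n) by rewrite bin_gt0; lia.
by rewrite -catalan_bin muln_gt0 => /andP[].
Qed.

(** Two absorption identities link the central binomials of [n] and [n + 1] through
    ['C(n.*2.+1, n)]. *)
Lemma catalanS n : n.+2 * catalan n.+1 = (n.*2.+1).*2 * catalan n.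
Proof.
have e1 := catalan_bin n.+1; have e0 := catalan_bin n.
have d1 := mul_bin_diag n.+1.*2 n; rewrite (_ : n.+1.*2.-1 = n.*2.+1) in d1; last by lia.
have d2 := mul_bin_down n.*2.+1 n; rewrite (_ : n.*2.+1 - n = n.+1) /= in d2; last by lia.
by nia.
Qed.

Lemma dyck_le s s' g : s <= s' -> dyck s g -> dyck s' g.
Proof. by case: g => [//|b g] ss /= /andP[bs ->]; rewrite (leq_trans bs ss). Qed.

Lemma dyck_cat s u v : 0 < s -> dyck s u -> dyck 1 v -> dyck s (u ++ v).
Proof.
elim: u s => [|b u IH] s s0 /=; first by move=> _; apply: dyck_le.
by move=> /andP[-> ub] vD; apply: IH.
Qed.

Lemma dyck_map_succ s u : dyck s u -> dyck s.+1 (map S u).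
Proof. by elim: u s => [//|b u IH] s /= /andP[bs /IH ->]; rewrite ltnS bs. Qed.

Lemma dyckP s g : reflect
  ((g != [::] -> nth 0 g 0 < s) /\
   forall i, i.+1 < size g -> nth 0 g i.+1 < (nth 0 g i).+2) (dyck s g).
Proof.
elim: g s => [|b g IH] s /=; first by left.
apply: (iffP andP) => [[bs /IH [h0 hS]]|[/(_ isT) bs hS]].
  split=> // -[|i] /=; last by rewrite ltnS; apply: hS.
  by case: g h0 {hS IH} => // c g /(_ isT).
split=> //; apply/IH; split=> [g0|i ig]; last by apply: (hS i.+1).
by apply: (hS 0); case: g g0 {hS IH}.
Qed.

Lemma dyck1_nth0 g : dyck 1 g -> nth 0 g 0 = 0.
Proof. by case: g => [//|b g] /= /andP[]; rewrite ltnS leqn0 => /eqP. Qed.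

(** * Block decomposition *)

(** First-return decomposition: a block has its only zero at its start, and lowering the other
    letters by one leaves an arbitrary Catalan word of length [z - 1]. *)
Fixpoint block_dycks (zs : seq nat) : seq (seq nat) :=
  if zs is z :: zs' then
    [seq (0 :: map S u) ++ v | u <- dycks 1 z.-1, v <- block_dycks zs']
  else [:: [::]].

Definition block_count (zs : seq nat) : nat :=
  foldr (fun z c => catalan z.-1 * c) 1 zs.

Local Notation pos_seq := (all (leq 1)).

Lemma size_block_dycks zs : size (block_dycks zs) = block_count zs.
Proof. by elim: zs => [//|z zs IH] /=; rewrite size_allpairs IH. Qed.

Lemma block_dycks_dyck zs g : g \in block_dycks zs -> dyck 1 g.
Proof.
elim: zs g => [|z zs IH] g /=; first by rewrite inE => /eqP->.
move=> /allpairsP[[u v] /= [uD /IH vD ->]] /=.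
by apply: dyck_cat => //; apply: dyck_map_succ; move: uD; rewrite mem_dycks => /andP[].
Qed.

Lemma block_dycks_size zs g :
  pos_seq zs -> g \in block_dycks zs -> size g = sumn zs.
Proof.
elim: zs g => [|z zs IH] g /=; first by rewrite inE => _ /eqP->.
move=> /andP[z0 zs0] /allpairsP[[u v] /= [uD /(IH _ zs0) vD ->]] /=.
move: uD; rewrite mem_dycks => /andP[/eqP su _].
by rewrite size_cat size_map su vD; lia.
Qed.

Lemma block_dycks_uniq zs : pos_seq zs -> uniq (block_dycks zs).
Proof.
elim: zs => [//|z zs IH] /= /andP[z0 zs0].
apply: allpairs_uniq; [exact: uniq_dycks|exact: IH|].
move=> [u v] [u' v'] /allpairsP[[u1 v1] /= [uD vD [-> ->]]].
move=> /allpairsP[[u2 v2] /= [u2D v2D [-> ->]]] [] /eqP.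
move: uD u2D; rewrite !mem_dycks => /andP[/eqP su _] /andP[/eqP su2 _].
rewrite eqseq_cat ?size_map ?su ?su2 // => /andP[/eqP e /eqP->].
by rewrite (inj_map _ e) // => x y [].
Qed.

(* The first block ends just before the second zero. *)
Lemma block_dycks_inj zs zs' g : pos_seq zs -> pos_seq zs' ->
  g \in block_dycks zs -> g \in block_dycks zs' -> zs = zs'.
Proof.
have first_zero u v : dyck 1 v -> index 0 (map S u ++ v) = size u.
  move=> vD; elim: u => [|b u IH] /=; last by rewrite IH.
  by case: v vD => [//|b v] /= /andP[]; rewrite ltnS leqn0 => ->.
have size_pred z u : 0 < z -> u \in dycks 1 z.-1 -> z = (size u).+1.
  by rewrite mem_dycks => z0 /andP[/eqP-> _]; lia.
elim: zs zs' g => [|z zs IH] [|z' zs'] g //=.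
- by rewrite inE => _ _ /eqP-> /allpairsP[[u v] /= []].
- by rewrite inE => _ _ /allpairsP[[u v] /= [_ _ ->]].
move=> /andP[z0 zs0] /andP[z0' zs0'] /allpairsP[[u v] /= [uD vD ->]].
move=> /allpairsP[[u' v'] /= [uD' vD' [e]]].
have su : size u = size u'.
  rewrite -(first_zero u v) ?(block_dycks_dyck vD) // e first_zero //.
  exact: block_dycks_dyck vD'.
rewrite (size_pred _ _ z0 uD) (size_pred _ _ z0' uD') su; congr cons.
have := e; move/eqP; rewrite eqseq_cat ?size_map // => /andP[_ /eqP ev].
by apply: (IH _ v) => //; rewrite ev.
Qed.

(** * Unit blocks and the atoms of the walk measure *)

Lemma walk_meas_nat_shift o d zs j :
  walk_meas_nat (o + d) zs (j + d) = walk_meas_nat o zs j.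
Proof.
elim: zs o => [//|z zs IH] o /=.
by rewrite addnAC IH eqn_add2r.
Qed.

Lemma walk_meas_nat_out o zs j :
  pos_seq zs -> (j <= o) || (o + sumn zs < j) -> walk_meas_nat o zs j = 0.
Proof.
elim: zs o => [//|z zs IH] o /= /andP[z0 zs0] jo.
rewrite IH //; last by lia.
by case: eqP => //= z1; case: eqP => //=; lia.
Qed.

Lemma walk_meas_nat_cat o zs zs' j :
  walk_meas_nat o (zs ++ zs') j =
  walk_meas_nat o zs j + walk_meas_nat (o + sumn zs) zs' j.
Proof.
elim: zs o => [|z zs IH] o /=; first by rewrite addn0.
by rewrite IH addnA addnA.
Qed.

(** Atoms come only from steps equal to 1. Such a step fills a single cell, and reversal sends cell
    [j] to cell [sumn zs + 1 - j]. *)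
Lemma walk_meas_nat_rev zs j : pos_seq zs -> 0 < j <= sumn zs ->
  walk_meas_nat 0 (rev zs) j = walk_meas_nat 0 zs ((sumn zs).+1 - j).
Proof.
elim: zs => [|z zs IH] /=; first by lia.
move=> /andP[z0 zs0] jz.
rewrite rev_cons -cats1 walk_meas_nat_cat /= !add0n addn0 sumn_rev addnC.
congr (_ + _).
  by case: eqP => //= z1; do 2 case: eqP => //=; lia.
have [js|js] := leqP j (sumn zs).
  rewrite IH //; last by lia.
  by rewrite -(walk_meas_nat_shift 0 z) add0n; congr walk_meas_nat; lia.
rewrite !walk_meas_nat_out ?all_rev ?sumn_rev //; lia.
Qed.

(** The default 0 of [nth] past the end makes a final block of size 1 count as well. *)
Definition double_zero (g : seq nat) (q : nat) : bool :=
  [&& q < size g, nth 0 g q == 0 & nth 0 g q.+1 == 0].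

(** A block has size 1 exactly when its opening zero is followed by another zero or by the end of
    the word; all other letters of a block are positive. *)
Lemma double_zero_walk zs g q : pos_seq zs -> g \in block_dycks zs ->
  walk_meas_nat 0 zs q.+1 = double_zero g q.
Proof.
rewrite /double_zero.
elim: zs g q => [|z zs IH] g q /=; first by rewrite inE => _ /eqP->.
move=> /andP[z0 zs0] /allpairsP[[u v] /= [uD vD ->]].
have vz := dyck1_nth0 (block_dycks_dyck vD).
have {uD} su : z = (size u).+1.
  by move: uD; rewrite mem_dycks => /andP[/eqP-> _]; lia.
rewrite add0n; case: (ltnP q z) => qz.
  (* Here [q] lies in the first block, and the later blocks only put atoms beyond [z]. *)
  rewrite walk_meas_nat_out //; last by lia.
  case: q qz => [|q] qz /=.
    by case: u su => [|b u] /= ->; rewrite ?vz.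
  have qu : q < size u by lia.
  rewrite nth_cat size_map qu (nth_map 0) // andbF.
  by case: eqP => //= z1; lia.
rewrite (_ : (z == q.+1) = false); last by lia.
rewrite andbF add0n -(@subnK z q.+1); last by lia.
rewrite -{1}[z]add0n walk_meas_nat_shift.
rewrite (_ : q.+1 - z = (q - z).+1); last by lia.
rewrite (IH v) // -cat_cons.
have ez : z = size (0 :: map S u) by rewrite /= size_map.
have eq0 : (q - z).+1 + z = q.+1 by lia.
rewrite eq0 !nth_cat -ez size_cat -ez.
rewrite (_ : (q < z) = false) 1?(_ : (q.+1 < z) = false); [|lia|lia].
rewrite (_ : q.+1 - z = (q - z).+1); last by lia.
by rewrite (_ : (q < z + size v) = (q - z < size v)) //; lia.
Qed.
(** Excesses are read from the right end of the permutation, so the right-end blocks [ys] come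
    first; [xs] is reversed because its first step sits at the left end. *)
Definition split_blocks (n : nat) (xs ys : seq nat) : seq nat :=
  ys ++ (n - (sumn xs + sumn ys)) :: rev xs.

(** The middle block has size at least 2, hence carries no atom, and the atoms of [rev xs] lie
    beyond [n - sumn xs]. *)
Lemma walk_meas_nat_split n xs ys j :
  pos_seq xs -> pos_seq ys -> (sumn xs + sumn ys).+1 < n -> j <= n - sumn xs ->
  walk_meas_nat 0 (split_blocks n xs ys) j = walk_meas_nat 0 ys j.
Proof.
move=> xs0 ys0 ltn jn; rewrite walk_meas_nat_cat /= add0n.
rewrite [walk_meas_nat _ (rev xs) j]walk_meas_nat_out ?all_rev //; last by lia.
by case: eqP => //=; lia.
Qed.

Lemma rev_split_blocks n xs ys :
  rev (split_blocks n xs ys) = split_blocks n ys xs.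
Proof. by rewrite rev_cat rev_cons revK -cats1 -catA /split_blocks addnC. Qed.

Lemma sumn_split_blocks n xs ys :
  sumn xs + sumn ys <= n -> sumn (split_blocks n xs ys) = n.
Proof. by rewrite sumn_cat /= sumn_rev; lia. Qed.

Lemma positive_split_blocks n xs ys : pos_seq xs -> pos_seq ys ->
  sumn xs + sumn ys < n -> pos_seq (split_blocks n xs ys).
Proof. by move=> xs0 ys0 ltn; rewrite all_cat /= all_rev xs0 ys0 /= andbT; lia. Qed.

(** The middle block is the only one longer than [n./2], so its position can be recovered from the
    list. *)
Lemma split_blocks_inj n xs ys xs' ys' :
  (sumn xs + sumn ys).*2 < n -> (sumn xs' + sumn ys').*2 < n ->
  split_blocks n xs ys = split_blocks n xs' ys' -> xs = xs' /\ ys = ys'.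
Proof.
have big_index (us vs : seq nat) : (sumn us + sumn vs).*2 < n ->
    find (fun z => n./2 < z) (split_blocks n us vs) = size vs.
  move=> ltn; rewrite find_cat ifN /=; first by rewrite ifT ?addn0 //; lia.
  apply/hasPn => z zv; suff : z <= sumn vs by lia.
  elim: vs zv {ltn} => [//|v vs IH] /=; rewrite inE => /orP[/eqP->|/IH]; lia.
move=> h h' e; have sz : size ys = size ys' by rewrite -(big_index xs) // e big_index.
move/eqP: e; rewrite /split_blocks eqseq_cat // => /andP[/eqP-> /eqP[_ /(congr1 rev)]].
by rewrite !revK.
Qed.

Lemma block_count_split n xs ys : block_count (split_blocks n xs ys) =
  block_count xs * block_count ys * catalan (n - (sumn xs + sumn ys)).-1.
Proof.
have cat us vs : block_count (us ++ vs) = block_count us * block_count vs.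
  by elim: us => [|u us IH] /=; rewrite ?mul1n // IH mulnA.
have rev us : block_count (rev us) = block_count us.
  by elim: us => [//|u us IH]; rewrite rev_cons -cats1 cat IH /=; nia.
by rewrite cat /= rev; nia.
Qed.
(** * 321-avoiding permutations *)

Definition mex (s : seq nat) : nat :=
  find (fun v => v \notin s) (iota 0 (size s).+1).

Lemma mex_le s : mex s <= size s.
Proof.
rewrite /mex -ltnS -[X in _ < X](size_iota 0) -has_find.
apply/negPn/negP => /hasPn h.
have sub : {subset iota 0 (size s).+1 <= s} by move=> v /h; rewrite negbK.
by have := uniq_leq_size (iota_uniq _ _) sub; rewrite size_iota ltnn.
Qed.

Lemma mex_notin s : mex s \notin s.
Proof.
have h : has (fun v => v \notin s) (iota 0 (size s).+1).
  by rewrite has_find size_iota ltnS mex_le.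
by have := nth_find 0 h; rewrite nth_iota ?ltnS ?mex_le.
Qed.

Lemma mem_lt_mex s v : v < mex s -> v \in s.
Proof.
move=> h; have := before_find 0 h; rewrite nth_iota ?add0n; first by move/negPn.
by rewrite ltnS; apply: leq_trans (ltnW h) (mex_le s).
Qed.

(** Values are shifted by one so that the empty maximum is 0 and lying above the diagonal reads
    [i <= runmax t i]. *)
Definition runmax (t : nat -> nat) (i : nat) : nat := \max_(j < i) (t j).+1.

Lemma runmaxS t i : runmax t i.+1 = maxn (runmax t i) (t i).+1.
Proof. by rewrite /runmax big_ord_recr. Qed.

Lemma lt_runmax t i j : j < i -> t j < runmax t i.
Proof. by move=> ji; apply: (@leq_bigmax _ (fun j : 'I_i => (t j).+1) (Ordinal ji)). Qed.

Lemma runmax_le t i b : (forall j, j < i -> t j < b) -> runmax t i <= b.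
Proof. by move=> h; apply/bigmax_leqP => j _; apply: h. Qed.

Lemma runmax_ge t i : uniq (mkseq t i) -> i <= runmax t i.
Proof.
move=> u; have := @uniq_leq_size _ _ (iota 0 (runmax t i)) u.
rewrite size_mkseq size_iota; apply=> v /mapP[j]; rewrite mem_iota => /= ji ->.
by rewrite mem_iota /= lt_runmax.
Qed.

(* In a 321-avoiding word the entry at a position that is not a record is the
   least value not seen so far, so the word is determined by its running
   maximum [M]. *)
Definition greedy (M t : nat -> nat) (n : nat) : Prop := forall i, i < n ->
  t i = if M i < M i.+1 then (M i.+1).-1 else mex (mkseq t i).

Definition avoids321 (n : nat) (t : nat -> nat) : Prop := forall i j k,
  i < j -> j < k -> k < n -> t j < t i -> t k < t j -> False.

Lemma greedy_unique M t t' n : greedy M t n -> greedy M t' n ->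
  forall i, i < n -> t i = t' i.
Proof.
move=> gt gt'; elim/ltn_ind => i IH ilt; rewrite gt // gt' //.
case: ifP => // _; congr mex; apply/eq_in_map => j; rewrite mem_iota => /= ji.
by apply: IH => //; apply: ltn_trans ilt.
Qed.

(** An entry depends on the whole prefix, so prefixes are built first and entries are read off as
    last letters. *)
Fixpoint greedy_word (M : nat -> nat) (i : nat) : seq nat :=
  if i is i'.+1 then
    rcons (greedy_word M i')
      (if M i' < M i then (M i).-1 else mex (greedy_word M i'))
  else [::].

Lemma greedy_exists M : exists t, forall n, greedy M t n.
Proof.
exists (fun i => last 0 (greedy_word M i.+1)) => n i _.
set t := fun i => _; suff e : greedy_word M i = mkseq t i.
  by rewrite {1}/t /= last_rcons e.
elim: i => [//|i IH]; rewrite mkseqS -IH.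
by rewrite {1}/t /= last_rcons.
Qed.

Definition staircase (M : nat -> nat) (n : nat) : Prop :=
  [/\ M 0 = 0, forall i, i < n -> M i <= M i.+1 & forall i, i <= n -> i <= M i].

(** A record takes a value at least [M i], above everything before it. At a non-record
    [M i = M i.+1 > i], while the mex of [i] entries is at most [i], so the maximum does not
    change. *)
Lemma greedy_runmax M t n : staircase M n -> greedy M t n ->
  forall i, i <= n -> runmax t i = M i /\ uniq (mkseq t i).
Proof.
move=> [M0 Mmono Mge] gt; elim=> [|i IH] ilt; first by rewrite /runmax big_ord0 M0.
have [e u] := IH (ltnW ilt); have := Mmono _ ilt; have := Mge _ ilt.
rewrite runmaxS e mkseqS rcons_uniq u andbT => ge le.
have := gt _ ilt; case: ltnP => [lt|ge'] ti.
  split; first by rewrite ti; lia.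
  apply/negP => /mapP[j]; rewrite mem_iota => /= ji tj.
  by have := lt_runmax t ji; rewrite e -tj ti; lia.
rewrite ti mex_notin; split=> //.
by have := mex_le (mkseq t i); rewrite size_mkseq; lia.
Qed.

(** The middle entry of a 321 pattern is not a record, so it is the mex of its prefix; the smaller
    [t k] then already occurs before [j], against distinctness. *)
Lemma greedy_avoids M t n : staircase M n -> greedy M t n -> avoids321 n t.
Proof.
move=> sM gt i j k ij jk kn tij tjk; have rm := greedy_runmax sM gt.
have jn : j < n by apply: ltn_trans kn.
have [e _] := rm j (ltnW jn).
have := lt_runmax t ij; have := gt j jn; rewrite e.
case: ifP => [|_] tj; first by case: sM => _ /(_ _ jn); lia.
have := @mem_lt_mex (mkseq t j) (t k); rewrite -tj tjk => /(_ isT).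
move=> /mapP[l]; rewrite mem_iota => /= lj tl _.
have [_] := rm k.+1 kn; rewrite mkseqS rcons_uniq => /andP[/negP[]].
by rewrite tl; apply: map_f; rewrite mem_iota /=; lia.
Qed.

(** * Permutations as words, and their excess words *)

Definition perm_word (n : nat) (tau : 'S_n) (i : nat) : nat :=
  if insub i is Some x then val (tau x) else 0.

Lemma perm_word_ord n (tau : 'S_n) (x : 'I_n) : perm_word tau x = tau x.
Proof. by rewrite /perm_word valK. Qed.

Lemma perm_word_lt n (tau : 'S_n) i : i < n -> perm_word tau i < n.
Proof. by move=> ilt; rewrite (perm_word_ord tau (Ordinal ilt)) ltn_ord. Qed.

Lemma perm_word_inj n (tau : 'S_n) i j : i < n -> j < n ->
  perm_word tau i = perm_word tau j -> i = j.
Proof.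
move=> ilt jlt; rewrite (perm_word_ord tau (Ordinal ilt)).
by rewrite (perm_word_ord tau (Ordinal jlt)) => /val_inj/perm_inj[].
Qed.

Lemma perm_word_uniq n (tau : 'S_n) i : i <= n -> uniq (mkseq (perm_word tau) i).
Proof.
move=> ilt; apply/mkseq_uniqP => j k /= ji ki; apply: perm_word_inj.
  exact: leq_trans ilt.
exact: leq_trans ilt.
Qed.

Lemma mem_Av321 n (tau : 'S_n) :
  reflect (avoids321 n (perm_word tau)) (tau \in Av n p321).
Proof.
rewrite inE /avoids; apply: (iffP negP) => [h i j k ij jk kn tij tjk|h].
  have jn : j < n by apply: ltn_trans kn.
  have lt_in : i < n by apply: ltn_trans jn.
  apply: h; pose f := [ffun s : 'I_3 =>
    nth (Ordinal kn) [:: Ordinal lt_in; Ordinal jn; Ordinal kn] s].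
  apply/existsP; exists f; apply/forallP => s; apply/forallP => u; apply/implyP => su.
  have -> : (p321 s < p321 u) = false by rewrite !permE /=; move: (ltn_ord u); lia.
  have key : (f s < f u) /\ (perm_word tau (f u) < perm_word tau (f s)).
    rewrite /f !ffunE.
    case: s u su => [[|[|[|s]]] hs] [[|[|[|u]]] hu] //= _; split=> //=;
      by [apply: ltn_trans ij _|apply: ltn_trans tjk _].
  case: key => -> /=; rewrite !perm_word_ord; lia.
move=> /existsP[f /forallP fP].
have key (s u : 'I_3) : s < u -> f s < f u /\ tau (f u) < tau (f s).
  move=> su; have := fP s => /forallP/(_ u)/implyP/(_ su)/andP[fsu].
  have -> : (p321 s < p321 u) = false by rewrite !permE /=; move: (ltn_ord u); lia.
  move=> /eqP e; split=> //; rewrite ltn_neqAle leqNgt e andbT.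
  by apply/eqP => /val_inj/perm_inj ee; move: fsu; rewrite ee ltnn.
have [a b] := key (@Ordinal 3 0 isT) (@Ordinal 3 1 isT) isT.
have [c d] := key (@Ordinal 3 1 isT) (@Ordinal 3 2 isT) isT.
by apply: (h _ _ _ a c (ltn_ord _)); rewrite !perm_word_ord.
Qed.

(** If a non-record exceeded the mex of its prefix, that missing value would come later and complete
    a 321 with an earlier, larger entry. *)
Lemma Av321_greedy n (tau : 'S_n) : tau \in Av n p321 ->
  greedy (runmax (perm_word tau)) (perm_word tau) n.
Proof.
move=> /mem_Av321 av; set t := perm_word tau => i ilt; rewrite runmaxS.
case: ltnP => h; first by lia.
have [j ji tij] : exists2 j, j < i & t i < t j.
  have {}h : t i < runmax t i by lia.
  have [|j e] := @eq_bigmax 'I_i (fun j => (t j).+1).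
    by rewrite card_ord lt0n; apply/eqP => i0; move: h; rewrite i0 /runmax big_ord0.
  rewrite -/(runmax t i) in e; exists j => //.
  suff : t i != t j by lia.
  apply/eqP => /(perm_word_inj ilt (ltn_trans (ltn_ord j) ilt)) ee.
  by have := ltn_ord j; rewrite -ee ltnn.
have tnotin : t i \notin mkseq t i.
  by have := perm_word_uniq tau ilt; rewrite mkseqS rcons_uniq => /andP[].
apply/eqP; rewrite eqn_leq; apply/andP; split; last first.
  by rewrite leqNgt; apply/negP => /mem_lt_mex; apply/negP.
rewrite leqNgt; apply/negP => lt; have vn := ltn_trans lt (perm_word_lt tau ilt).
have [k kn tk] : exists2 k, k < n & t k = mex (mkseq t i).
  exists (tau^-1%g (Ordinal vn)); first exact: ltn_ord.
  by rewrite /t perm_word_ord permKV.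
have [ki|ki] := ltnP k i.
  by have := mex_notin (mkseq t i); rewrite -tk => /negP[]; apply: map_f; rewrite mem_iota.
have {}ki : i < k by rewrite ltn_neqAle ki andbT; apply/eqP => e; move: tk; rewrite -e; lia.
by apply: (av j i k) => //; rewrite -/t tk.
Qed.

(** The excess [M i - i] drops by at most one per step, so read backwards it rises by at most one.
    Position 0 is left out: its excess is 0, the default of [nth]. *)
Definition heights (n : nat) (tau : 'S_n) : seq nat :=
  mkseq (fun q => runmax (perm_word tau) (n - q) - (n - q)) n.

Lemma nth_heights n (tau : 'S_n) q :
  nth 0 (heights tau) q = runmax (perm_word tau) (n - q) - (n - q).
Proof.
have [qn|qn] := ltnP q n; first by rewrite nth_mkseq.
rewrite nth_default ?size_mkseq // (_ : n - q = 0); last by lia.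
by rewrite /runmax big_ord0.
Qed.

Lemma runmax_heights n (tau : 'S_n) i : i <= n ->
  runmax (perm_word tau) i = nth 0 (heights tau) (n - i) + i.
Proof.
move=> ilt; rewrite nth_heights subKn // subnK // runmax_ge //.
exact: perm_word_uniq.
Qed.

Lemma heights_dyck n (tau : 'S_n) : dyck 1 (heights tau).
Proof.
apply/dyckP; split=> [|q]; rewrite ?size_mkseq => qn.
  rewrite nth_heights subn0 ltnS leqn0 subn_eq0.
  by apply: runmax_le => j; apply: perm_word_lt.
rewrite !nth_heights; have ge := runmax_ge (perm_word_uniq tau (leq_subr q n)).
have := runmaxS (perm_word tau) (n - q.+1).
by rewrite (_ : (n - q.+1).+1 = n - q); lia.
Qed.

Lemma heights_inj n : {in Av n p321 &, injective (@heights n)}.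
Proof.
move=> tau tau' /Av321_greedy g /Av321_greedy g' e.
apply/permP => x; apply/val_inj; rewrite /= -!perm_word_ord.
apply: (@greedy_unique (runmax (perm_word tau)) _ _ n) => // i ilt.
by rewrite g' // !runmax_heights ?e // ltnW.
Qed.

(** The staircase is rebuilt from [g] and filled greedily. Since [M n = n], the [n] distinct entries
    lie below [n] and form a permutation. *)
Lemma heights_surj n g : size g = n -> dyck 1 g ->
  exists2 tau, tau \in Av n p321 & heights tau = g.
Proof.
move=> sg gD; pose M i := nth 0 g (n - i) + i.
have sM : staircase M n.
  split; first by rewrite /M subn0 nth_default ?sg.
  - move=> i ilt; rewrite /M.
    have [->|i0] := posnP i; first by rewrite subn0 nth_default ?sg.
    have /dyckP[_ /(_ (n - i.+1))] := gD.
    by rewrite sg (_ : (n - i.+1).+1 = n - i); lia.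
  - by move=> i _; rewrite leq_addl.
have Mn : M n = n by rewrite /M subnn dyck1_nth0.
have [t /(_ n) gt] := greedy_exists M; have rm := greedy_runmax sM gt.
have tn i : i < n -> t i < n.
  by move=> ilt; have := lt_runmax t ilt; rewrite (rm n _).1 ?Mn.
pose f (x : 'I_n) := Ordinal (tn x (ltn_ord x)).
have f_inj : injective f.
  move=> x y [] e; apply/val_inj.
  by have [_ /mkseq_uniqP] := rm n (leqnn n); apply; rewrite // inE ltn_ord.
have tw i : i < n -> perm_word (perm f_inj) i = t i.
  by move=> ilt; rewrite (perm_word_ord _ (Ordinal ilt)) permE.
exists (perm f_inj).
  apply/mem_Av321 => i j k ij jk kn; rewrite !tw //; try lia.
  exact: (greedy_avoids sM gt).
apply: (@eq_from_nth _ 0) => [|q]; rewrite size_mkseq ?sg // => qn.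
rewrite nth_heights (_ : runmax _ _ = runmax t (n - q)).
  by rewrite (rm _ (leq_subr _ _)).1 /M subKn ?addnK // ltnW.
by apply: eq_bigr => j _; rewrite tw //; have := ltn_ord j; lia.
Qed.

Lemma heights_Av321 n :
  perm_eq [seq heights tau | tau <- enum (Av n p321)] (dycks 1 n).
Proof.
apply: uniq_perm; last 1 first.
- move=> g; rewrite mem_dycks; apply/mapP/andP => [[tau _ ->]|[/eqP sg gD]].
    by rewrite size_mkseq heights_dyck.
  by have [tau tauA <-] := heights_surj sg gD; exists tau; rewrite ?mem_enum.
- rewrite map_inj_in_uniq ?enum_uniq // => tau tau'.
  by rewrite !mem_enum; apply: heights_inj.
- exact: uniq_dycks.
Qed.

(** Both excesses vanish when the first [p - 1] and the first [p] entries each fill an initial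
    interval, which for a 321-avoider is the same as fixing [p]. *)
Lemma fixes1_heights n (tau : 'S_n) p : tau \in Av n p321 -> 0 < p <= n ->
  fixes1 tau p = double_zero (heights tau) (n - p).
Proof.
move=> tauA pn; have gt := Av321_greedy tauA; set t := perm_word tau in gt.
have plt : p.-1 < n by lia.
have -> : fixes1 tau p = (t p.-1 == p.-1).
  rewrite /t (perm_word_ord tau (Ordinal plt)).
  apply/existsP/eqP => [[x /andP[/andP[/eqP xp _] /eqP tx]]|e].
    by rewrite (_ : Ordinal plt = x) ?tx //; apply/val_inj.
  exists (Ordinal plt); rewrite eqxx /=; apply/andP; split; first by lia.
  by apply/eqP/val_inj.
rewrite /double_zero size_mkseq !nth_heights -/t.
have gep : p <= runmax t p by apply/runmax_ge/perm_word_uniq; lia.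
have gep1 : p.-1 <= runmax t p.-1 by apply/runmax_ge/perm_word_uniq; lia.
rewrite (_ : n - (n - p) = p); last by lia.
rewrite (_ : n - (n - p).+1 = p.-1); last by lia.
have rp : runmax t p = maxn (runmax t p.-1) (t p.-1).+1 by rewrite -runmaxS prednK //; lia.
apply/eqP/idP => [tp|/and3P[_ /eqP e1 /eqP e2]]; last by lia.
suff : runmax t p.-1 <= p.-1 by lia.
have := gt _ plt; rewrite prednK; last by lia.
case: ltnP => [|_]; first by lia.
(* Non-record case: the first [p - 1] entries have mex [p - 1], so they are exactly the values below
   [p - 1]. *)
rewrite tp => e; apply: runmax_le => j jp.
have sub : {subset iota 0 p.-1 <= mkseq t p.-1}.
  by move=> v; rewrite mem_iota /= add0n {1}e => /mem_lt_mex.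
have [|_ eqi] := uniq_min_size (iota_uniq 0 p.-1) sub.
  by rewrite size_mkseq size_iota.
have : t j \in iota 0 p.-1 by rewrite eqi; apply: map_f; rewrite mem_iota.
by rewrite mem_iota.
Qed.

Local Open Scope R_scope.

(** * Finite sums and weighted series *)

Fact RplusA : associative Rplus. Proof. by move=> x y z; lra. Qed.
Fact RplusC : commutative Rplus. Proof. by move=> x y; lra. Qed.
Fact Rplus0x : left_id 0 Rplus. Proof. by move=> x; lra. Qed.
#[warnings="-redundant-canonical-projection"]
HB.instance Definition _ := Monoid.isComLaw.Build R 0 Rplus RplusA RplusC Rplus0x.

Local Notation "'rsum_' ( i <- r ) F" := (\big[Rplus/0]_(i <- r) F)
  (at level 41, F at level 41, i, r at level 50).

Lemma rsum_mull (I : Type) c (s : seq I) (F : I -> R) :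
  rsum_(i <- s) (c * F i) = c * rsum_(i <- s) F i.
Proof. by elim: s => [|i s IH]; rewrite ?big_nil ?big_cons ?IH; lra. Qed.

Lemma rsum_const (I : Type) (s : seq I) c : rsum_(i <- s) c = INR (size s) * c.
Proof.
elim: s => [|i s IH]; first by rewrite big_nil /=; lra.
by rewrite big_cons IH -[size (i :: s)]/(size s).+1 S_INR; lra.
Qed.

Lemma rsum_sub (I : Type) (s : seq I) (F G : I -> R) :
  rsum_(i <- s) (F i - G i) = rsum_(i <- s) F i - rsum_(i <- s) G i.
Proof. by elim: s => [|i s IH]; rewrite ?big_nil ?big_cons ?IH; lra. Qed.

Lemma rsum_abs_le (I : eqType) (s : seq I) (F G : I -> R) :
  {in s, forall i, Rabs (F i) <= G i} ->
  Rabs (rsum_(i <- s) F i) <= rsum_(i <- s) G i.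
Proof.
elim: s => [|i s IH] h; rewrite ?big_nil ?big_cons; first by rewrite Rabs_R0; lra.
apply: Rle_trans (Rabs_triang _ _) _; apply: Rplus_le_compat.
  by apply: h; rewrite mem_head.
by apply: IH => j js; apply: h; rewrite inE js orbT.
Qed.

Lemma rsum_uniq_sub_le (I : eqType) (s s' : seq I) (F : I -> R) B :
  uniq s -> uniq s' -> {subset s' <= s} ->
  (forall i, Rabs (F i) <= B) ->
  Rabs (rsum_(i <- s) F i - rsum_(i <- s') F i) <= B * (INR (size s) - INR (size s')).
Proof.
move=> us us' sub FB.
have pe : perm_eq s (s' ++ [seq x <- s | x \notin s']).
  apply: uniq_perm => //.
    rewrite cat_uniq us' filter_uniq // andbT; apply/hasPn => x.
    by rewrite mem_filter => /andP[].
  move=> x; rewrite mem_cat mem_filter.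
  by case xs' : (x \in s') => //=; apply: sub.
rewrite (perm_big _ pe) (perm_size pe) big_cat size_cat plus_INR /=.
set r := [seq _ <- _ | _]; have := rsum_abs_le (fun i (_ : i \in r) => FB i).
rewrite rsum_const; set S := (X in Rabs X <= _ -> _); set S' := (X in Rabs (X + _ - _)).
by rewrite (_ : S' + S - S' = S); lra.
Qed.

Lemma Un_cv_rsum (I : eqType) (s : seq I) (a : nat -> I -> R) (l : I -> R) :
  {in s, forall i, Un_cv (fun n => a n i) (l i)} ->
  Un_cv (fun n => rsum_(i <- s) a n i) (rsum_(i <- s) l i).
Proof.
elim: s => [|i s IH] h.
  rewrite big_nil => eps eps0; exists 0%N => n _; rewrite big_nil.
  by rewrite /Rdist Rminus_diag Rabs_R0.
rewrite big_cons.
have -> : (fun n => rsum_(j <- i :: s) a n j) = (fun n => a n i + rsum_(j <- s) a n j).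
  by apply: functional_extensionality => n; rewrite big_cons.
apply: CV_plus; first by apply: h; rewrite mem_head.
by apply: IH => j js; apply: h; rewrite inE js orbT.
Qed.

Lemma rsum_iotaS u n :
  rsum_(k <- iota 0 n.+1) u k = rsum_(k <- iota 0 n) u k + u n.
Proof. by rewrite -addn1 iotaD big_cat big_seq1. Qed.

Lemma sum_f_R0_rsum u n : sum_f_R0 u n = rsum_(k <- iota 0 n.+1) u k.
Proof.
by elim: n => [|n IH]; rewrite rsum_iotaS -?IH ?big_nil /=; lra.
Qed.

Lemma sumR_spec u : (exists l, infinite_sum u l) -> infinite_sum u (sumR u).
Proof. by move=> h; rewrite /sumR; case: (X in proj1_sig X) => l /= /(_ h). Qed.

Lemma sumR_eq u l : infinite_sum u l -> sumR u = l.
Proof. by move=> h; apply: (uniqueness_sum u _ _ _ h); apply: sumR_spec; exists l. Qed.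

Lemma infinite_sum_mull c u l :
  infinite_sum u l -> infinite_sum (fun k => c * u k) (c * l).
Proof. by move=> /is_series_Reals h; apply/is_series_Reals/(is_series_scal c u l h). Qed.

Section WeightedSeries.
Variables (p : nat -> R).
Hypotheses (p0 : forall k, 0 <= p k) (p1 : infinite_sum p 1).

Lemma weighted_series_cv e B : (forall k, Rabs (e k) <= B) ->
  infinite_sum (fun k => p k * e k) (sumR (fun k => p k * e k)).
Proof.
move=> eB; apply: sumR_spec.
have [l hl] : ex_series (fun k => p k * e k).
  apply: (@ex_series_le R_AbsRing R_CompleteNormedModule _ (fun k => B * p k)) => [k|].
    rewrite /norm /= /abs /= Rabs_mult (Rabs_pos_eq (p k)) //.
    by rewrite Rmult_comm; apply: Rmult_le_compat_r.
  by exists (B * 1); apply/is_series_Reals/infinite_sum_mull.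
by exists l; apply/is_series_Reals.
Qed.

Lemma partial_sum_le1 n : rsum_(k <- iota 0 n) p k <= 1.
Proof.
case: n => [|n]; first by rewrite big_nil; lra.
by rewrite -sum_f_R0_rsum; apply: sum_incr.
Qed.

(** The first [N] terms cost at most [d], as the weights sum to at most 1, and the tail costs [B]
    times its mass. Letting [e'] differ from [e] allows nested truncations. *)
Lemma sumR_trunc e e' B d N : (forall k, Rabs (e k) <= B) -> 0 <= d ->
  (forall k, (k < N)%N -> Rabs (e k - e' k) <= d) ->
  Rabs (sumR (fun k => p k * e k) - rsum_(k <- iota 0 N) (p k * e' k))
    <= d + B * (1 - rsum_(k <- iota 0 N) p k).
Proof.
move=> eB d0 ee'; have cv := weighted_series_cv eB.
have B0 : 0 <= B by apply: Rle_trans (eB 0%N); apply: Rabs_pos.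
set c := (X in Rabs (_ - X)); set D := (X in _ <= X).
suff partial n : (N <= n)%N -> Rabs (sum_f_R0 (fun k => p k * e k) n - c) <= D.
  apply: le_epsilon => eps eps0; have [n0 hn0] := cv eps eps0.
  have := hn0 (maxn n0 N) (ltac:(lia)); have := partial (maxn n0 N) (leq_maxr _ _).
  by rewrite /Rdist; split_Rabs; lra.
move=> Nn; rewrite sum_f_R0_rsum /c.
rewrite (_ : n.+1 = (N + (n.+1 - N))%N); last by lia.
rewrite iotaD big_cat /= add0n; set r := iota N _.
rewrite [X in Rabs X](_ : _ = rsum_(k <- iota 0 N) (p k * (e k - e' k)) +
    rsum_(k <- r) (p k * e k)); last first.
  have -> : rsum_(k <- iota 0 N) (p k * (e k - e' k)) =
     rsum_(k <- iota 0 N) (p k * e k - p k * e' k) by apply: eq_bigr => k _; lra.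
  by rewrite rsum_sub; lra.
apply: Rle_trans (Rabs_triang _ _) _.
have b1 : Rabs (rsum_(k <- iota 0 N) (p k * (e k - e' k)))
    <= rsum_(k <- iota 0 N) (d * p k).
  apply: rsum_abs_le => k; rewrite mem_iota /= => kN.
  rewrite Rabs_mult (Rabs_pos_eq (p k)) // Rmult_comm.
  by apply: Rmult_le_compat_r => //; apply: ee'.
have b2 : Rabs (rsum_(k <- r) (p k * e k)) <= rsum_(k <- r) (B * p k).
  apply: rsum_abs_le => k _; rewrite Rabs_mult (Rabs_pos_eq (p k)) // Rmult_comm.
  exact: Rmult_le_compat_r.
rewrite !rsum_mull in b1 b2.
have := partial_sum_le1 n.+1; have := partial_sum_le1 N.
rewrite (_ : n.+1 = (N + (n.+1 - N))%N); last by lia.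
by rewrite iotaD big_cat /= add0n -/r /D => h1 h2; nra.
Qed.

Lemma sumR_abs_le e B : (forall k, Rabs (e k) <= B) ->
  Rabs (sumR (fun k => p k * e k)) <= B.
Proof.
(* Truncation after no terms leaves the full mass 1 as tail. *)
move=> eB; have := @sumR_trunc e e B 0 0 eB (Rle_refl 0).
by rewrite /= !big_nil Rminus_0_r Rminus_0_r Rplus_0_l Rmult_1_r; apply.
Qed.

End WeightedSeries.

(** * The step and geometric laws *)

(* By [catalan_bin] this is ['C(2n, n) / 4 ^ n], the tail of the series [pX]. *)
Definition central_ratio n := INR n.+1 * INR (catalan n) / 4 ^ n.

(** The step law weighs a block by its [catalan k] fillings, at the critical parameter 1/4. *)
Lemma pX_catalan k : pX k.+1 = 2 * INR (catalan k) * (/ 4) ^ k.+1.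
Proof.
rewrite /pX (_ : (k.+1.*2 - 2)%N = k.*2); last by lia.
rewrite -[k.+1.-1]/k -catalan_bin mult_INR.
have -> : 2 ^ (k.+1.*2 - 1) = 2 * 4 ^ k.
  rewrite (_ : (k.+1.*2 - 1)%N = (2 * k).+1); last by lia.
  by rewrite -tech_pow_Rmult pow_mult; congr (_ * _ ^ _); lra.
rewrite -[k.+1]/(S k) [(/ 4) ^ _]/= pow_inv.
have := pow_lt 4 k (ltac:(lra)); have := pos_INR k.
by rewrite S_INR => hk h4; field; lra.
Qed.

Lemma central_ratioS n :
  central_ratio n.+1 = central_ratio n * (2 * INR n + 1) / (2 * INR n + 2).
Proof.
have := congr1 INR (catalanS n).
rewrite (_ : (n.*2.+1).*2 = (4 * n + 2)%N); last by lia.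
rewrite !mult_INR plus_INR mult_INR /central_ratio => ->.
rewrite (S_INR n) [INR 4]/= [INR 2]/= [4 ^ n.+1]/=.
by have := pow_lt 4 n (ltac:(lra)); have := pos_INR n => hn h4; field; lra.
Qed.

(** A Wallis-type bound; the induction rests on [(2x + 1)(2x + 3) <= (2x + 2)^2]. *)
Lemma central_ratio_bound n :
  0 <= central_ratio n /\ central_ratio n ^ 2 * (2 * INR n + 1) <= 1.
Proof.
elim: n => [|n [IH0 IH]]; first by rewrite /central_ratio /=; lra.
rewrite central_ratioS S_INR; move: (central_ratio n) IH0 IH => b b0 hb.
have := pos_INR n; move: (INR n) hb => x hb x0.
have -> : b * (2 * x + 1) / (2 * x + 2) = b * ((2 * x + 1) / (2 * x + 2)) by field; lra.
set r := (2 * x + 1) / (2 * x + 2).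
have r0 : 0 <= r by apply: Rcomplements.Rdiv_le_0_compat; lra.
split; first by nra.
have er : r * (2 * x + 2) = 2 * x + 1 by rewrite /r; field; lra.
have hr : r ^ 2 * (2 * (x + 1) + 1) <= 2 * x + 1.
  apply: (Rmult_le_reg_r (2 * x + 2)); first by lra.
  have -> : r ^ 2 * (2 * (x + 1) + 1) * (2 * x + 2) =
     r * (2 * x + 3) * (r * (2 * x + 2)) by ring.
  rewrite er; apply: (Rmult_le_reg_r (2 * x + 2)); first by lra.
  have -> : r * (2 * x + 3) * (2 * x + 1) * (2 * x + 2) =
     (r * (2 * x + 2)) * (2 * x + 3) * (2 * x + 1) by ring.
  by rewrite er; nra.
have -> : (b * r) ^ 2 * (2 * (x + 1) + 1) = b ^ 2 * (r ^ 2 * (2 * (x + 1) + 1)) by ring.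
apply: Rle_trans hb; apply: Rmult_le_compat_l hr; exact: pow2_ge_0.
Qed.

Lemma central_ratio_cv : Un_cv central_ratio 0.
Proof.
move=> eps eps0; have [n0 [h0 /lt_0_INR n00]] := archimed_cor1 (eps ^ 2) (pow_lt _ _ eps0).
exists n0.+1 => n nn0; rewrite /Rdist Rminus_0_r.
have [b0 hb] := central_ratio_bound n; rewrite Rabs_pos_eq //.
apply: Rnot_le_lt => le.
have hn : INR n0 + 1 <= INR n by rewrite -S_INR; apply: le_INR; lia.
have hn0 := pos_INR n0.
have e2 : eps ^ 2 <= central_ratio n ^ 2 by apply: pow_incr; lra.
have : 1 < eps ^ 2 * INR n0.
  have := Rmult_lt_compat_r _ _ _ n00 h0; rewrite Rinv_l; lra.
by nra.
Qed.

(** Telescoping: [pX k.+1 = central_ratio k - central_ratio k.+1]. *)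
Lemma pX_partial_sum K : rsum_(k <- iota 0 K) pX k.+1 = 1 - central_ratio K.
Proof.
elim: K => [|K IH]; first by rewrite big_nil /central_ratio /=; lra.
rewrite rsum_iotaS IH central_ratioS pX_catalan.
rewrite /central_ratio pow_inv S_INR /=.
by have := pow_lt 4 K (ltac:(lra)); have := pos_INR K => hn h4; field; lra.
Qed.

Lemma pX_ge0 k : 0 <= pX k.+1.
Proof.
rewrite pX_catalan; apply: Rmult_le_pos; last by apply: pow_le; lra.
by have := pos_INR (catalan k); lra.
Qed.

Lemma pX_sum1 : infinite_sum (fun k => pX k.+1) 1.
Proof.
move=> eps eps0; have [n0 h] := central_ratio_cv eps0.
exists n0 => n nn0; have := h n.+1 (ltac:(lia)).
by rewrite sum_f_R0_rsum pX_partial_sum /Rdist; split_Rabs; lra.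
Qed.

Lemma pGeom_partial_sum N : rsum_(k <- iota 0 N) pGeom k = 1 - (/ 2) ^ N.
Proof.
elim: N => [|N IH]; first by rewrite big_nil /=; lra.
by rewrite rsum_iotaS IH /pGeom /=; lra.
Qed.

Lemma half_pow_cv : Un_cv (fun n => (/ 2) ^ n) 0.
Proof.
move=> eps eps0; have [|N h] := pow_lt_1_zero (/ 2) _ eps eps0.
  by rewrite Rabs_pos_eq; lra.
by exists N => n nN; rewrite /Rdist Rminus_0_r; apply: h.
Qed.

Lemma pGeom_ge0 k : 0 <= pGeom k. Proof. by apply: pow_le; lra. Qed.

Lemma pGeom_sum1 : infinite_sum pGeom 1.
Proof.
move=> eps eps0; have [n0 h] := half_pow_cv eps0.
exists n0 => n nn0; have := h n.+1 (ltac:(lia)).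
by rewrite sum_f_R0_rsum pGeom_partial_sum /Rdist; split_Rabs; lra.
Qed.

(** * Truncating the limit law to finitely many step lists *)

Fixpoint trunc_lists (K n : nat) : seq (seq nat) :=
  if n is n'.+1 then [seq k.+1 :: l | k <- iota 0 K, l <- trunc_lists K n']
  else [:: [::]].

Definition wX (xs : seq nat) : R := foldr (fun x w => pX x * w) 1 xs.

Lemma iid_expect_abs_le n h B : (forall xs, Rabs (h xs) <= B) ->
  Rabs (iid_expect n h) <= B.
Proof.
elim: n h => [|n IH] h hB /=; first exact: hB.
apply: (sumR_abs_le pX_ge0 pX_sum1) => k.
by apply: IH.
Qed.

(** Each of the [n] series loses mass [central_ratio K]. Allowing [h'] to differ from [h] lets an
    inner expectation be replaced by its own truncation. *)
Lemma iid_expect_trunc K n h h' B d : (forall xs, Rabs (h xs) <= B) ->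
  (forall xs, Rabs (h xs - h' xs) <= d) ->
  Rabs (iid_expect n h - rsum_(xs <- trunc_lists K n) (wX xs * h' xs))
    <= d + INR n * (B * central_ratio K).
Proof.
elim: n h h' => [|n IH] h h' hB hh'.
  by rewrite /= big_seq1 /=; have := hh' [::]; rewrite Rmult_1_l; lra.
have d0 : 0 <= d by apply: Rle_trans (hh' [::]); apply: Rabs_pos.
have B0 : 0 <= B by apply: Rle_trans (hB [::]); apply: Rabs_pos.
have [r0 _] := central_ratio_bound K.
have e0 : 0 <= d + INR n * (B * central_ratio K).
  by apply: Rplus_le_le_0_compat => //; apply: Rmult_le_pos (pos_INR n) _; apply: Rmult_le_pos.
have -> : rsum_(xs <- trunc_lists K n.+1) (wX xs * h' xs) =
    rsum_(k <- iota 0 K) (pX k.+1 * rsum_(l <- trunc_lists K n) (wX l * h' (k.+1 :: l))).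
  rewrite [trunc_lists _ _]/= big_allpairs_dep; apply: eq_bigr => k _.
  by rewrite -rsum_mull; apply: eq_bigr => l _; rewrite /= Rmult_assoc.
rewrite [iid_expect _ _]/=.
have := sumR_trunc pX_ge0 pX_sum1 (e := fun k => iid_expect n (fun l => h (k.+1 :: l)))
  (e' := fun k => rsum_(l <- trunc_lists K n) (wX l * h' (k.+1 :: l))) (B := B) (N := K) _ e0 _.
rewrite pX_partial_sum => T; apply: Rle_trans (T _ _) _.
- by move=> k; apply: iid_expect_abs_le.
- by move=> k _; apply: IH.
- by rewrite S_INR; lra.
Qed.

Definition trunc_family (N K : nat) : seq (seq nat) :=
  [seq xs | n <- iota 0 N, xs <- trunc_lists K n].

(** The probability that [N = size xs] and that the first [N] steps are [xs]. *)
Definition weight (xs : seq nat) : R := pGeom (size xs) * wX xs.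

Lemma size_trunc_lists K n xs : xs \in trunc_lists K n -> size xs = n.
Proof.
elim: n xs => [|n IH] xs /=; first by rewrite inE => /eqP->.
by move=> /allpairsP[[k l] /= [_ /IH <- ->]].
Qed.

Lemma rsum_trunc_family N K F :
  rsum_(xs <- trunc_family N K) (weight xs * F xs) =
  rsum_(n <- iota 0 N) (pGeom n * rsum_(xs <- trunc_lists K n) (wX xs * F xs)).
Proof.
rewrite big_allpairs_dep; apply: eq_bigr => n _; rewrite -rsum_mull.
rewrite big_seq [RHS]big_seq; apply: eq_bigr => xs /size_trunc_lists <-.
by rewrite /weight Rmult_assoc.
Qed.

(** At most [2 * N] steps each lose the mass [central_ratio K] beyond [K], and the two geometric
    tails lose [(/ 2) ^ N] each. *)
Lemma rhs_trunc G B N K : (forall xs ys, Rabs (G xs ys) <= B) ->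
  Rabs (sumR (fun n => sumR (fun m => pGeom n * pGeom m *
          iid_expect n (fun xs => iid_expect m (fun ys => G xs ys))))
        - rsum_(xs <- trunc_family N K) rsum_(ys <- trunc_family N K)
            (weight xs * weight ys * G xs ys))
  <= B * (2 * INR N * central_ratio K + 2 * (/ 2) ^ N).
Proof.
move=> GB; have B0 : 0 <= B by apply: Rle_trans (GB [::] [::]); apply: Rabs_pos.
have [r0 _] := central_ratio_bound K.
have Br0 : 0 <= B * central_ratio K by apply: Rmult_le_pos.
pose X n m := iid_expect n (fun xs => iid_expect m (fun ys => G xs ys)).
pose S n m := rsum_(xs <- trunc_lists K n) (wX xs *
  rsum_(ys <- trunc_lists K m) (wX ys * G xs ys)).
have XB n m : Rabs (X n m) <= B.
  by apply: iid_expect_abs_le => xs; apply: iid_expect_abs_le.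
have XS n m : Rabs (X n m - S n m) <= (INR n + INR m) * (B * central_ratio K).
  have -> : (INR n + INR m) * (B * central_ratio K) =
    (0 + INR m * (B * central_ratio K)) + INR n * (B * central_ratio K) by ring.
  apply: iid_expect_trunc => xs; first exact: iid_expect_abs_le.
  by apply: iid_expect_trunc => // ys; rewrite Rminus_diag Rabs_R0; lra.
have -> : (fun n => sumR (fun m => pGeom n * pGeom m * X n m)) =
          (fun n => pGeom n * sumR (fun m => pGeom m * X n m)).
  apply: functional_extensionality => n; apply: sumR_eq.
  have -> : (fun m => pGeom n * pGeom m * X n m) = (fun m => pGeom n * (pGeom m * X n m)).
    by apply: functional_extensionality => m; ring.
  apply: infinite_sum_mull.
  exact: (weighted_series_cv pGeom_ge0 pGeom_sum1 (XB n)).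
have -> : rsum_(xs <- trunc_family N K) rsum_(ys <- trunc_family N K)
      (weight xs * weight ys * G xs ys) =
    rsum_(n <- iota 0 N) (pGeom n * rsum_(m <- iota 0 N) (pGeom m * S n m)).
  transitivity (rsum_(xs <- trunc_family N K) (weight xs *
      rsum_(ys <- trunc_family N K) (weight ys * G xs ys))).
    apply: eq_bigr => xs _; rewrite -rsum_mull; apply: eq_bigr => ys _; ring.
  rewrite rsum_trunc_family; apply: eq_bigr => n _; congr (_ * _).
  transitivity (rsum_(xs <- trunc_lists K n) rsum_(m <- iota 0 N)
      (pGeom m * (wX xs * rsum_(ys <- trunc_lists K m) (wX ys * G xs ys)))).
    apply: eq_bigr => xs _; rewrite rsum_trunc_family -rsum_mull.
    by apply: eq_bigr => m _; ring.
  by rewrite exchange_big; apply: eq_bigr => m _; rewrite rsum_mull.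
have N0 := pos_INR N; have h0 := pow_le (/ 2) N (ltac:(lra)).
set d := 2 * INR N * (B * central_ratio K).
have d0 : 0 <= d by apply: Rmult_le_pos => //; lra.
have inner n : (n < N)%N -> Rabs (sumR (fun m => pGeom m * X n m) -
    rsum_(m <- iota 0 N) (pGeom m * S n m)) <= d + B * (/ 2) ^ N.
  move=> nN; have := sumR_trunc pGeom_ge0 pGeom_sum1 (N := N) (e' := S n) (XB n) d0.
  rewrite pGeom_partial_sum (_ : 1 - (1 - (/ 2) ^ N) = (/ 2) ^ N); last by ring.
  apply=> m mN; apply: Rle_trans (XS n m) _; apply: Rmult_le_compat_r => //.
  have : INR n <= INR N by apply: le_INR; lia.
  have : INR m <= INR N by apply: le_INR; lia.
  lra.
have outerB n : Rabs (sumR (fun m => pGeom m * X n m)) <= B.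
  exact: (sumR_abs_le pGeom_ge0 pGeom_sum1).
have dd : 0 <= d + B * (/ 2) ^ N by apply: Rplus_le_le_0_compat => //; apply: Rmult_le_pos.
have := sumR_trunc pGeom_ge0 pGeom_sum1 outerB dd inner.
rewrite pGeom_partial_sum /d => T; apply: Rle_trans T _; lra.
Qed.

(** Comparing this total mass with its truncation bounds the mass that a truncated family misses. *)
Lemma rhs_expect_one : sumR (fun n => sumR (fun m => pGeom n * pGeom m *
  iid_expect n (fun xs => iid_expect m (fun ys => 1)))) = 1.
Proof.
have iid1 n : iid_expect n (fun _ => 1) = 1.
  elim: n => [//|n /= ->]; apply: sumR_eq.
  rewrite (_ : (fun k => _) = (fun k => pX k.+1)); first exact: pX_sum1.
  by apply: functional_extensionality => k; rewrite Rmult_1_r.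
apply: sumR_eq; rewrite (_ : (fun n => _) = pGeom); first exact: pGeom_sum1.
apply: functional_extensionality => n; apply: sumR_eq.
rewrite (_ : (fun m => _) = (fun m => pGeom n * pGeom m)).
  by rewrite -[X in infinite_sum _ X]Rmult_1_r; apply/infinite_sum_mull/pGeom_sum1.
by apply: functional_extensionality => m; rewrite !iid1 Rmult_1_r.
Qed.

Lemma trunc_lists_uniq K n : uniq (trunc_lists K n).
Proof.
elim: n => [//|n IH] /=; apply: allpairs_uniq => //; first exact: iota_uniq.
by move=> [k l] [k' l'] _ _ [-> ->].
Qed.

Lemma trunc_family_uniq N K : uniq (trunc_family N K).
Proof.
elim: N => [//|N IH]; rewrite /trunc_family -addn1 iotaD allpairs_cat cat_uniq IH.
rewrite /= cats0 map_id trunc_lists_uniq andbT; apply/hasPn => xs /size_trunc_lists sx.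
apply/negP => /allpairsPdep[n [l [nN /size_trunc_lists sl e]]].
by move: nN; rewrite mem_iota -sl -e sx ltnn andbF.
Qed.

Lemma trunc_family_positive N K xs : xs \in trunc_family N K -> pos_seq xs.
Proof.
move=> /allpairsPdep[n [l [_ + ->]]]; elim: n l => [|n IH] l /=.
  by rewrite inE => /eqP->.
by move=> /allpairsP[[k l'] /= [_ /IH h ->]].
Qed.

(** The factor 2 in each [pX] cancels the factor 1/2 that each further step costs in the geometric
    law. *)
Lemma weight_block_count xs : pos_seq xs ->
  weight xs = / 2 * INR (block_count xs) * (/ 4) ^ sumn xs.
Proof.
rewrite /weight; elim: xs => [|x xs IH]; first by rewrite /pGeom /=; lra.
case: x => [//|x] /IH e.
rewrite -[block_count _]/(catalan x * block_count xs)%N mult_INR.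
rewrite -[sumn _]/(x.+1 + sumn xs)%N pow_add.
rewrite -[wX _]/(pX x.+1 * wX xs) -[pGeom _]/(/ 2 * pGeom (size xs)) pX_catalan.
transitivity (INR (catalan x) * (/ 4) ^ x.+1 * (pGeom (size xs) * wX xs)); first by field.
by rewrite e; ring.
Qed.

(** * Limits of Catalan ratios and of block probabilities *)

Lemma catalan_ratio_cv k :
  is_lim_seq (fun n => INR (catalan n) / INR (catalan (n + k))) ((/ 4) ^ k).
Proof.
have cat0 n : 0 < INR (catalan n) by apply: lt_0_INR; have := catalan_gt0 n; lia.
elim: k => [|k IH].
  apply: (is_lim_seq_ext (fun _ => 1)); last exact: is_lim_seq_const.
  by move=> n; rewrite addn0; have := cat0 n => h; field; lra.
have step : is_lim_seq (fun n => INR (catalan n) / INR (catalan n.+1)) (/ 4).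
  (* Partial fractions of the exact ratio [(n + 2) / (4n + 2)]. *)
  apply: (is_lim_seq_ext (fun n => / 4 + 3 / 8 * / (INR n + / 2))).
    move=> n; have := congr1 INR (catalanS n).
    rewrite (_ : (n.*2.+1).*2 = (4 * n + 2)%N); last by lia.
    rewrite !mult_INR plus_INR mult_INR [INR 4]/= [INR 2]/= !S_INR.
    have := cat0 n; have := cat0 n.+1; have := pos_INR n.
    move: (INR (catalan n)) (INR (catalan n.+1)) (INR n) => a b x x0 b0 a0 e.
    have -> : b = (4 * x + 2) / (x + 2) * a.
      apply: (Rmult_eq_reg_l (x + 2)); last by lra.
      have -> : (x + 2) * ((4 * x + 2) / (x + 2) * a) = (4 * x + 2) * a by field; lra.
      lra.
    by field; lra.
  rewrite (_ : Rbar.Finite (/ 4) = Rbar.Finite (/ 4 + 3 / 8 * 0)); last by congr Rbar.Finite; ring.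
  apply: is_lim_seq_plus'; first exact: is_lim_seq_const.
  apply: (is_lim_seq_scal_l _ (3 / 8) 0).
  apply: (is_lim_seq_inv _ p_infty) => //.
  apply: (is_lim_seq_plus _ _ p_infty (/ 2)) => //.
  - exact: is_lim_seq_INR.
  - exact: is_lim_seq_const.
apply: (is_lim_seq_ext (fun n => INR (catalan n) / INR (catalan n.+1) *
    (INR (catalan n.+1) / INR (catalan (n.+1 + k))))).
  move=> n; rewrite addSnnS; have := cat0 n.+1; have := cat0 (n + k.+1)%N.
  by move=> h1 h2; field; lra.
apply: (is_lim_seq_mult' _ _ (/ 4) ((/ 4) ^ k)) => //.
by move/is_lim_seq_incr_1: IH.
Qed.

(** The middle block contributes [catalan (n - r) / catalan n], which tends to [(/ 4) ^ r]; as [r]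
    is one more than the total length, the extra 1/4 supplies the two factors 1/2 of the weights. *)
Lemma block_count_ratio_cv xs ys : pos_seq xs -> pos_seq ys ->
  Un_cv (fun n => INR (block_count (split_blocks n xs ys)) / INR (catalan n))
        (weight xs * weight ys).
Proof.
move=> xs0 ys0; apply/is_lim_seq_Reals; set r := (sumn xs + sumn ys).+1.
apply/(is_lim_seq_incr_n _ r).
have := @catalan_ratio_cv r => /(is_lim_seq_scal_l _ (INR (block_count xs * block_count ys))).
rewrite (_ : Rbar_mult _ _ = Rbar.Finite (weight xs * weight ys)); last first.
  rewrite /= !weight_block_count // /r mult_INR /=.
  rewrite pow_add.
  by congr Rbar.Finite; field.
apply: is_lim_seq_ext => n; rewrite block_count_split !mult_INR.
rewrite (_ : (_ - _).-1 = n); last by rewrite /r; lia.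
by rewrite /Rdiv -!Rmult_assoc.
Qed.

(** * Convergence *)

(** Position [j] of the permutation corresponds to letter [n - j] of its word. *)
Definition left_meas (n : nat) (w : seq nat) (j : nat) : R :=
  if (1 <= j <= n./2)%N && double_zero w (n - j) then 1 else 0.

(** Position [n + 1 - j] corresponds to letter [j - 1]. *)
Definition right_meas (n : nat) (w : seq nat) (j : nat) : R :=
  if (1 <= j <= n - n./2)%N && double_zero w j.-1 then 1 else 0.

Lemma lhs_heights n (tau : 'S_n) : tau \in Av n p321 ->
  lhs1 tau = left_meas n (heights tau) /\ lhs2 tau = right_meas n (heights tau).
Proof.
move=> tauA; split; apply: functional_extensionality => j.
  rewrite /lhs1 /left_meas; case: (boolP (1 <= j <= n./2)%N) => //= jn.
  by rewrite fixes1_heights //; lia.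
rewrite /lhs2 /right_meas; case: (boolP (1 <= j <= n - n./2)%N) => //= jn.
by rewrite fixes1_heights // 1?(_ : (n - (n.+1 - j))%N = j.-1) //; lia.
Qed.

Lemma lhs_expect_dycks n g : lhs_expect n g =
  / INR (catalan n) * rsum_(w <- dycks 1 n) g (left_meas n w) (right_meas n w).
Proof.
have pe := heights_Av321 n; rewrite /lhs_expect cardE; congr (/ INR _ * _).
  by rewrite /catalan -(perm_size pe) size_map.
rewrite -(perm_big _ pe) big_map /= [RHS]big_enum_cond /=.
apply: eq_big => [tau|tau /lhs_heights[-> ->] //]; by rewrite andbT.
Qed.

Lemma finite_measure_support mu b : mu 0%N = 0 -> (forall j, 0 <= mu j) ->
  (forall j, (b < j)%N -> mu j = 0) -> finite_measure mu.
Proof.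
move=> mu0 mu_ge0 mub; split=> //; split=> //; exists (sum_f_R0 mu b) => eps eps0.
exists b => n bn; suff -> : sum_f_R0 mu n = sum_f_R0 mu b.
  by rewrite /Rdist Rminus_diag Rabs_R0.
elim: bn => [//|m /leP bm IH] /=; rewrite IH mub ?ltnS; first by lra.
by apply/leP; move/leP: bm.
Qed.

Lemma left_meas_finite n w : finite_measure (left_meas n w).
Proof.
apply: (@finite_measure_support _ n) => //.
- by move=> j; rewrite /left_meas; case: ifP; lra.
- by move=> j nj; rewrite /left_meas ifF //; apply/negP => /andP[]; lia.
Qed.

Lemma right_meas_finite n w : finite_measure (right_meas n w).
Proof.
apply: (@finite_measure_support _ n) => //.
- by move=> j; rewrite /right_meas; case: ifP; lra.
- by move=> j nj; rewrite /right_meas ifF //; apply/negP => /andP[]; lia.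
Qed.

Lemma walk_meas_finite xs : finite_measure (walk_meas xs).
Proof.
have zero o j : (j <= o)%N || (o + sumn xs < j)%N -> walk_meas_nat o xs j = 0%N.
  elim: xs o => [//|x xs IH] o /= h; rewrite IH; last by lia.
  by case: eqP => //= x1; case: eqP => //=; lia.
apply: (@finite_measure_support _ (sumn xs)) => [|j|j jb]; rewrite /walk_meas.
- by rewrite zero.
- exact: pos_INR.
- by rewrite zero // jb orbT.
Qed.

(** The bound on [n] keeps each end part inside its own half and the middle block longer than 1. *)
Lemma meas_block_dycks n xs ys w : pos_seq xs -> pos_seq ys ->
  ((sumn xs + sumn ys).*2.+3 < n)%N -> w \in block_dycks (split_blocks n xs ys) ->
  left_meas n w = walk_meas xs /\ right_meas n w = walk_meas ys.
Proof.
move=> xs0 ys0 ltn wB.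
have pos : pos_seq (split_blocks n xs ys) by apply: positive_split_blocks => //; lia.
have INR_bool (b : bool) : INR (nat_of_bool b) = (if b then 1 else 0) by case: b.
split; apply: functional_extensionality => j; rewrite /walk_meas.
  rewrite /left_meas; case: (boolP (1 <= j <= n./2)%N) => jn /=; last first.
    by rewrite walk_meas_nat_out //; move: jn; lia.
  rewrite -(INR_bool (double_zero w _)) -(double_zero_walk _ pos wB).
  rewrite -(@walk_meas_nat_split n ys xs) //; [|lia|lia].
  (* Reversing the blocks exchanges the two ends, so the left measure is treated like the right
     one. *)
  rewrite -(rev_split_blocks n xs ys) walk_meas_nat_rev ?sumn_split_blocks //; try lia.
  by congr (INR (walk_meas_nat _ _ _)); lia.
rewrite /right_meas; case: (boolP (1 <= j <= n - n./2)%N) => jn /=; last first.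
  by rewrite walk_meas_nat_out //; move: jn; lia.
rewrite -(INR_bool (double_zero w _)) -(double_zero_walk _ pos wB) prednK; last by lia.
by rewrite walk_meas_nat_split //; lia.
Qed.

(** [a p] is the proportion of words with end blocks [p]. These classes are disjoint, the integrand
    is constant on each, and the other words have proportion one minus the sum. *)
Lemma lhs_trunc n g B (F : seq (seq nat)) :
  (forall m1 m2, finite_measure m1 -> finite_measure m2 -> Rabs (g m1 m2) <= B) ->
  uniq F -> {in F, forall xs, pos_seq xs} ->
  {in F &, forall xs ys, ((sumn xs + sumn ys).*2.+3 < n)%N} ->
  let a p := INR (block_count (split_blocks n p.1 p.2)) / INR (catalan n) in
  let Q := [seq (xs, ys) | xs <- F, ys <- F] in
  Rabs (lhs_expect n g - rsum_(p <- Q) (a p * g (walk_meas p.1) (walk_meas p.2)))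
    <= B * (1 - rsum_(p <- Q) a p).
Proof.
move=> gB uF F0 Fn a Q.
have QP p : p \in Q -> [/\ pos_seq p.1, pos_seq p.2,
    ((sumn p.1 + sumn p.2).*2.+3 < n)%N & pos_seq (split_blocks n p.1 p.2)].
  move=> /allpairsP[[xs ys] /= [xF yF ->]] /=; have h := Fn _ _ xF yF.
  have x0 := F0 _ xF; have y0 := F0 _ yF.
  by split=> //; apply: positive_split_blocks => //; lia.
have c0 : 0 < INR (catalan n) by apply: lt_0_INR; have := catalan_gt0 n; lia.
pose Phi w := g (left_meas n w) (right_meas n w).
pose bd p := block_dycks (split_blocks n p.1 p.2).
pose L := flatten [seq bd p | p <- Q].
(* A word determines its blocks, and these determine [xs] and [ys]. *)
have uL : uniq L.
  have uQ : uniq Q by apply: allpairs_uniq => // -[? ?] [? ?] _ _ [-> ->].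
  rewrite /L; elim: (Q) uQ QP => [//|p s IH] /= /andP[ps us] sP.
  have psP q : q \in s -> _ := fun qs => sP q (mem_behead (qs : q \in behead (p :: s))).
  have [p1 p2 pn pp] := sP p (mem_head _ _).
  rewrite cat_uniq block_dycks_uniq // IH // andbT; apply/hasPn => w.
  move=> /flatten_mapP[q qs wq]; apply/negP => wp.
  have [q1 q2 qn qp] := psP q qs; move: ps; suff -> : p = q by rewrite qs.
  have /split_blocks_inj[||e1 e2] := block_dycks_inj pp qp wp wq; try lia.
  by rewrite (surjective_pairing p) e1 e2 -surjective_pairing.
have sL : {subset L <= dycks 1 n}.
  move=> w /flatten_mapP[p /QP[p1 p2 pn pp] wp]; rewrite mem_dycks.
  by rewrite (block_dycks_dyck wp) (block_dycks_size pp wp) sumn_split_blocks ?eqxx //; lia.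
have sizeL : INR (size L) = INR (catalan n) * rsum_(p <- Q) a p.
  rewrite -rsum_mull /L; elim: (Q) => [|p s IH]; first by rewrite big_nil.
  rewrite /= size_cat plus_INR big_cons IH size_block_dycks; congr (_ + _).
  by rewrite /a; field; lra.
have sumL : rsum_(w <- L) Phi w =
    INR (catalan n) * rsum_(p <- Q) (a p * g (walk_meas p.1) (walk_meas p.2)).
  rewrite -rsum_mull /L big_flatten big_map big_seq [RHS]big_seq.
  apply: eq_bigr => p /QP[p1 p2 pn pp].
  transitivity (rsum_(w <- bd p) g (walk_meas p.1) (walk_meas p.2)).
    rewrite big_seq [RHS]big_seq; apply: eq_bigr => w wp.
    by rewrite /Phi; have [-> ->] := meas_block_dycks p1 p2 pn wp.
  rewrite rsum_const size_block_dycks /a; case: p {p1 p2 pn pp} => xs ys /=.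
  by field; lra.
have := @rsum_uniq_sub_le _ (dycks 1 n) L Phi B (uniq_dycks 1 n) uL sL.
rewrite sumL sizeL -/(catalan n) => T.
have {}T := T (fun w => gB _ _ (left_meas_finite n w) (right_meas_finite n w)).
rewrite lhs_expect_dycks; set S := rsum_(w <- _) _ in T *.
set c := INR _ in c0 T *; set U := rsum_(p <- Q) (_ * _) in T *; set A := rsum_(p <- Q) _ in T *.
have -> : / c * S - U = / c * (S - c * U) by field; lra.
have ic0 := Rinv_0_lt_compat _ c0.
rewrite Rabs_mult (Rabs_pos_eq (/ c)); last by lra.
apply: (Rle_trans _ (/ c * (B * (c - c * A)))); first by apply: Rmult_le_compat_l; lra.
by apply: Req_le; field; lra.
Qed.

(** [N] is chosen first, against the geometric tails, and then [K] in terms of [N]. *)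
Lemma truncation_error_small eps : 0 < eps ->
  exists N K, 2 * INR N * central_ratio K + 2 * (/ 2) ^ N < eps.
Proof.
move=> eps0; have [|N hN] := @half_pow_cv (eps / 4); first by lra.
have {}hN := hN N (le_n N); rewrite /Rdist Rminus_0_r in hN.
have N0 := pos_INR N; have d0 : 0 < eps / (4 * (INR N + 1)).
  by apply: Rdiv_lt_0_compat; lra.
have [K hK] := central_ratio_cv d0; have {}hK := hK K (le_n K).
rewrite /Rdist Rminus_0_r in hK; have [r0 _] := central_ratio_bound K.
exists N, K; rewrite Rabs_pos_eq in hK => //.
have e : eps / (4 * (INR N + 1)) * (4 * (INR N + 1)) = eps by field; lra.
have := Rle_abs ((/ 2) ^ N); nra.
Qed.

Theorem theorem1p1 : conv_in_distribution.
Proof.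
move=> g [B0 gB0] _ eps eps0.
(* Adding 1 makes the bound positive, so that dividing by [B] is legitimate. *)
pose B := Rabs B0 + 1; have B_gt0 : 0 < B by have := Rabs_pos B0; rewrite /B; lra.
have gB m1 m2 : finite_measure m1 -> finite_measure m2 -> Rabs (g m1 m2) <= B.
  by move=> h1 h2; have := gB0 _ _ h1 h2; have := Rle_abs B0; rewrite /B; lra.
have [|N [K hNK]] := @truncation_error_small (eps / (8 * B)).
  by apply: Rdiv_lt_0_compat; lra.
set err := _ + _ in hNK.
have Berr : B * err < eps / 8.
  have -> : eps / 8 = B * (eps / (8 * B)) by field; lra.
  exact: Rmult_lt_compat_l.
pose F := trunc_family N K; pose Q := [seq (xs, ys) | xs <- F, ys <- F].
pose G (p : seq nat * seq nat) := g (walk_meas p.1) (walk_meas p.2).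
pose w (p : seq nat * seq nat) := weight p.1 * weight p.2.
pose a n (p : seq nat * seq nat) :=
  INR (block_count (split_blocks n p.1 p.2)) / INR (catalan n).
have GB p : Rabs (G p) <= B by apply: gB; apply: walk_meas_finite.
have hT : Rabs (rhs_expect g - rsum_(p <- Q) (w p * G p)) <= B * err.
  rewrite big_allpairs; apply: (rhs_trunc N K (G := fun xs ys => G (xs, ys))) => xs ys.
  exact: GB.
have hM : Rabs (1 - rsum_(p <- Q) w p) <= err.
  have := @rhs_trunc (fun _ _ => 1) 1 N K _; rewrite rhs_expect_one => h.
  rewrite big_allpairs -[X in _ <= X]Rmult_1_l.
  under eq_bigr => xs _ do under eq_bigr => ys _ do rewrite -[w _]Rmult_1_r.
  by apply: h => _ _; rewrite Rabs_R1; lra.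
have aw p : p \in Q -> Un_cv (fun n => a n p) (w p).
  move=> /allpairsP[[xs ys] /= [xF yF ->]].
  by apply: block_count_ratio_cv; apply: trunc_family_positive; [exact: xF|exact: yF].
have cvM : Un_cv (fun n => rsum_(p <- Q) a n p) (rsum_(p <- Q) w p) by apply: Un_cv_rsum.
have cvT : Un_cv (fun n => rsum_(p <- Q) (a n p * G p)) (rsum_(p <- Q) (w p * G p)).
  apply: Un_cv_rsum => p pQ; apply: CV_mult; first exact: aw.
  by move=> e e0; exists 0%N => n _; rewrite /Rdist Rminus_diag Rabs_R0.
have [|n1 hn1] := cvM (eps / (8 * B)); first by apply: Rdiv_lt_0_compat; lra.
have [|n2 hn2] := cvT (eps / 8); first by lra.
(* For [n >= 4b + 4], twice the joint length of two lists of [F], plus 3, stays below [n]. *)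
pose b := (\max_(xs <- F) sumn xs)%N.
exists (maxn (maxn n1 n2) (b * 4 + 4)) => n nge.
have := hn1 n (ltac:(lia)); have := hn2 n (ltac:(lia)); rewrite /Rdist => h2 h1.
have Fb xs : xs \in F -> (sumn xs <= b)%N.
  by move=> xF; rewrite /b (big_rem xs) //= leq_maxl.
have := @lhs_trunc n g B F gB (trunc_family_uniq N K) (@trunc_family_positive N K).
move=> /(_ _)-L; have {}L := L (ltac:(by move=> xs ys /Fb hx /Fb hy; lia)).
rewrite -/Q -/(a n) in L.
have e8 : B * (eps / (8 * B)) = eps / 8 by field; lra.
have h1' : B * Rabs (rsum_(p <- Q) a n p - rsum_(p <- Q) w p) < eps / 8.
  by rewrite -e8; apply: Rmult_lt_compat_l.
have hM' : B * Rabs (1 - rsum_(p <- Q) w p) <= B * err.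
  by apply: Rmult_le_compat_l => //; lra.
move: L hT h1' hM' h2; rewrite /G /=.
set T := rsum_(p <- Q) (w p * _); set Tn := rsum_(p <- Q) (a n p * _).
set M := rsum_(p <- Q) w p; set Mn := rsum_(p <- Q) a n p => L hT h1' hM' h2.
(* Scheffe's step: the mass missed at level [n] is controlled by the convergence of the captured
   mass and by the mass missed in the limit. *)
have key : B * (1 - Mn) <= B * Rabs (Mn - M) + B * Rabs (1 - M).
  have -> : B * Rabs (Mn - M) + B * Rabs (1 - M) = B * (Rabs (Mn - M) + Rabs (1 - M)) by ring.
  by apply: Rmult_le_compat_l; [lra|split_Rabs; lra].
(* The first difference is below [eps / 4], the other two are below [eps / 8] each. *)
have -> : lhs_expect n g - rhs_expect g =
  (lhs_expect n g - Tn) + (Tn - T) + - (rhs_expect g - T) by ring.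
apply: Rle_lt_trans (Rabs_triang _ _) _; rewrite Rabs_Ropp.
apply: Rle_lt_trans (Rplus_le_compat_r _ _ _ (Rabs_triang _ _)) _; lra.
Qed.
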